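(* Let $n,t$ be non-negative integers with $n\geq t+1$ and let $M$ be a matroid on $E(K_n)$. Consider the following properties of $M$: (R1* ) the rank of $M$ is $\binom{t+1}{2}$; (R2* ) every copy of $K_{n-t+1}$ is a cocircuit in $M$; (R3* ) every copy of $K_{1,t+1}$ is a circuit in $M$. Then the following statements are equivalent: (i) $M$ satisfies (R1* ) and (R2* ); (ii) $M$ satisfies (R1* ) and (R3* ); (iii) $M$ satisfies (R2* ) and (R3* ); (iv) the dual matroid $M^*$ is an abstract $(n-t-1)$-rigidity matroid on $K_n$.
   Context: For a matroid on $E(K_n)$, a subgraph $G\subseteq K_n$ is said to have a matroid property (circuit, cocircuit, ...) if its edge set $E(G)$ does; a ''copy'' of a graph $H$ is a subgraph of $K_n$ isomorphic to $H$. For $F\subseteq E(K_n)$, $V(F)$ denotes the set of vertices incident to edges of $F$; for a vertex set $X$, $K(X)$ denotes the edge set of the complete graph on $X$. An abstract $d$-rigidity matroid on $K_n$ is a matroid $N$ on the edge set of the complete graph $K_n$, with $n\geq d+1$, whose closure operator $\mathrm{cl}_N$ satisfies the following two axioms: (G1) if $E_1,E_2\subseteq E(K_n)$ with $|V(E_1)\cap V(E_2)|\leq d-1$, then $\mathrm{cl}_N(E_1\cup E_2)\subseteq K(V(E_1))\cup K(V(E_2))$; (G2) if $E_1,E_2\subseteq E(K_n)$ with $\mathrm{cl}_N(E_1)=K(V(E_1))$, $\mathrm{cl}_N(E_2)=K(V(E_2))$ and $|V(E_1)\cap V(E_2)|\geq d$, then $\mathrm{cl}_N(E_1\cup E_2)=K(V(E_1\cup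 E_2))$.
   Formalization: The implication from (iv) to (i)-(iii) is claimed only for n > t+1 or n = 1: for n = t+1 ≥ 2 it is false, since (G1) is then vacuous (e.g. M* uniform of rank 1 satisfies (iv) but not (R1* ) or (R2* )). All other implications are kept for all n ≥ t+1. *)

(* Defs.v *)
From mathcomp Require Import all_boot.

Set Implicit Arguments.
Unset Strict Implicit.
Unset Printing Implicit Defensive.

(* Finite matroids, by independent sets; the ground set is the whole of [E]. *)
Record matroid (E : finType) := Matroid {
  indep : pred {set E};
  indep_set0 : indep set0;
  indep_subset : forall I J : {set E}, I \subset J -> indep J -> indep I;
  indep_augment : forall I J : {set E}, indep I -> indep J -> #|I| < #|J| ->
    exists2 e, e \in J :\: I & indep (e |: I)
}.

Section MatroidNotions.
Variables (E : finType) (M : matroid E).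
Implicit Types I J B C X : {set E}.

Definition basis B : bool := maxset (indep M) B.

Definition circuit C : bool := minset (fun X => ~~ indep M X) C.

Definition mrank X : nat := \max_(I : {set E} | indep M I && (I \subset X)) #|I|.

Definition mcl X : {set E} := [set e | mrank (e |: X) == mrank X].

Definition coindep I : bool := [exists B, basis B && [disjoint I & B]].

Lemma indep_le_basis I B : indep M I -> basis B -> #|I| <= #|B|.
Proof.
move=> iI /maxsetP[iB maxB]; rewrite leqNgt; apply/negP => ltBI.
have [e eIB ieB] := indep_augment iB iI ltBI.
have eB : e \notin B by move: eIB; rewrite inE => /andP[].
by move: eB; rewrite -(maxB _ ieB (subsetUr _ _)) setU11.
Qed.

Lemma indep_extend I B : indep M I -> basis B ->
  exists B', [/\ basis B', I \subset B' & B' \subset I :|: B].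
Proof.
move=> iI bB.
pose P := fun X => [&& indep M X, I \subset X & X \subset I :|: B].
have PI : P I by rewrite /P iI subxx subsetUl.
have [B' /maxsetP[/and3P[iB' sIB' sB'] maxB'] _] := maxset_exists PI.
exists B'; split=> //.
have leBB' : #|B| <= #|B'|.
  rewrite leqNgt; apply/negP => lt.
  have iB : indep M B by case/maxsetP: bB.
  have [e eD ie] := indep_augment iB' iB lt.
  move: eD; rewrite inE => /andP[eB' eB].
  have PeB' : P (e |: B').
    rewrite /P ie (subset_trans sIB' (subsetUr _ _)) /=.
    by rewrite subUset sB' sub1set inE eB orbT.
  by move: eB'; rewrite -(maxB' _ PeB' (subsetUr _ _)) setU11.
apply/maxsetP; split=> // X iX sB'X; apply/esym/eqP.
by rewrite eqEcard sB'X (leq_trans (indep_le_basis iX bB)).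
Qed.

Lemma coindep_set0 : coindep set0.
Proof.
have [B bB _] := maxset_exists (indep_set0 M).
by apply/existsP; exists B; rewrite /basis bB disjoints_subset sub0set.
Qed.

Lemma coindep_subset I J : I \subset J -> coindep J -> coindep I.
Proof.
move=> sIJ /existsP[B /andP[bB dJB]]; apply/existsP; exists B.
by rewrite bB (disjointWl sIJ).
Qed.

Lemma coindep_augment I J : coindep I -> coindep J -> #|I| < #|J| ->
  exists2 e, e \in J :\: I & coindep (e |: I).
Proof.
move=> /existsP[B /andP[bB dIB]] /existsP[B1 /andP[bB1 dJB1]] ltIJ.
have iB1 : indep M B1 by case/maxsetP: bB1.
have [B2 [bB2 sB2 B2s]] := indep_extend (indep_subset (subsetDl B1 I) iB1) bB.
have dIB2 : [disjoint I & B2].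
  apply: disjointWr B2s _; rewrite disjoint_sym disjoints_subset subUset.
  by rewrite subDset setUCr subsetT -disjoints_subset disjoint_sym.
have [sJB2|/subsetPn[e eJI eB2]] := boolP (J :\: I \subset B2); last first.
  exists e => //; apply/existsP; exists B2.
  by rewrite bB2 disjoints_subset subUset sub1set inE eB2 -disjoints_subset.
have iB2 : indep M B2 by case/maxsetP: bB2.
have le21 := indep_le_basis iB2 bB1.
have dis : (J :\: I) :&: (B1 :\: I) = set0.
  apply/eqP; rewrite setI_eq0; apply: disjointWl (subsetDl _ _) _.
  exact: disjointWr (subsetDl _ _) dJB1.
have leU : #|J :\: I| + #|B1 :\: I| <= #|B2|.
  rewrite -cardsUI dis cards0 addn0; apply: subset_leq_card.
  by rewrite subUset sJB2.
have leI : #|B1 :&: I| <= #|I :\: J|.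
  apply: subset_leq_card; apply/subsetP => x; rewrite !inE => /andP[xB1 ->].
  by rewrite andbT; apply: contraL xB1 => /(disjointFr dJB1) ->.
have ltD : #|I :\: J| < #|J :\: I|.
  by rewrite -(ltn_add2l #|I :&: J|) cardsID setIC cardsID.
have := leq_trans leU le21; rewrite -(cardsID I B1) leq_add2r leqNgt.
by rewrite (leq_ltn_trans leI ltD).
Qed.

Definition dual : matroid E :=
  Matroid coindep_set0 coindep_subset coindep_augment.

End MatroidNotions.

Definition cocircuit (E : finType) (M : matroid E) (C : {set E}) : bool :=
  circuit (dual M) C.

Notation edge n := {e : {set 'I_n} | #|e| == 2}.

Section CompleteGraph.
Variable n : nat.
Implicit Types (F : {set edge n}) (X : {set 'I_n}).

Definition verts F : {set 'I_n} := \bigcup_(e in F) val e.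

Definition Kedges X : {set edge n} := [set e : edge n | val e \subset X].

(* [F] is the edge set of a subgraph of [K_n] isomorphic to the simple graph
   with vertex type [T] and adjacency relation [adj]. *)
Definition is_copy (T : finType) (adj : rel T) F : Prop :=
  exists2 f : T -> 'I_n, injective f &
    F = [set e : edge n | [exists x, exists y, adj x y && (val e == [set f x; f y])]].

(* In the first closure axiom the bound |V(E1) :&: V(E2)| <= d - 1 is over the integers, hence the
   strict inequality: for d = 0 it never holds. *)
Definition abstract_rigidity (d : nat) (N : matroid (edge n)) : Prop :=
  [/\ d.+1 <= n,
      forall E1 E2 : {set edge n},
        #|verts E1 :&: verts E2| < d ->
        mcl N (E1 :|: E2) \subset Kedges (verts E1) :|: Kedges (verts E2)
    & forall E1 E2 : {set edge n},
        mcl N E1 = Kedges (verts E1) -> mcl N E2 = Kedges (verts E2) ->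
        d <= #|verts E1 :&: verts E2| ->
        mcl N (E1 :|: E2) = Kedges (verts (E1 :|: E2))].

End CompleteGraph.

Definition complete_graph (m : nat) : rel 'I_m := fun x y => x != y.
Arguments complete_graph m : clear implicits.

Definition complete_bipartite (a b : nat) : rel ('I_a + 'I_b) :=
  fun x y => match x, y with
             | inl _, inr _ | inr _, inl _ => true
             | _, _ => false
             end.
Arguments complete_bipartite a b : clear implicits.

Section DualRigidityProperties.
Variables (n t : nat) (M : matroid (edge n)).

Definition R1star : Prop := mrank M setT = 'C(t.+1, 2).

Definition R2star : Prop :=
  forall F : {set edge n}, is_copy (complete_graph (n - t).+1) F -> cocircuit M F.

Definition R3star : Prop :=
  forall F : {set edge n}, is_copy (complete_bipartite 1 t.+1) F -> circuit M F.

End DualRigidityProperties.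

(* Main.v *)
Require Import Defs.
From mathcomp Require Import all_boot zify.

(* Everything is read off in M itself through the orthogonality of circuits and
   cocircuits. Under (R2) every K_{t+1} is independent: an edge uv of a circuit
   inside K_X, |X| = t + 1, would be the only common edge with the cocircuit on
   (V \ X) + {u, v}. Under (R3) every K_{t+1} spans, since the edges at a vertex of
   a star circuit are closed up one by one. Hence (R2) and (R3) give (R1); given the
   rank, a missing property is obtained by exhibiting a spanning set that is too
   small, or a basis that avoids a cocircuit.
   For the dual N, an edge lies outside cl_N(A) as soon as some circuit of M contains
   it and avoids A. Under (R1) and (R2) such circuits are found inside the bonds of
   the subgraphs K_{t+2}, which yields (G1), while (G2) comes from the circuits
   K_{n-t+1} of N. Conversely, (R3) says that the complement of a star is a
   non-spanning closed set of N by (G1) that (G2) makes spanning once any edge of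
   the star is added, and (G2) makes K_{n-t+1}, a union of two copies of K_{n-t}
   and one more edge, dependent in N. *)

Set Implicit Arguments.
Unset Strict Implicit.
Unset Printing Implicit Defensive.

Lemma disjointsU1 (T : finType) (x : T) (A B : {set T}) :
  [disjoint x |: A & B] = (x \notin B) && [disjoint A & B].
Proof. by rewrite !disjoints_subset subUset sub1set inE. Qed.

(** * Rank, closure, circuits and bases of a matroid *)

Section MatroidTheory.
Variables (E : finType) (M : matroid E).
Implicit Types (I J B C A X : {set E}) (e : E).

Lemma indep_le_mrank I X : indep M I -> I \subset X -> #|I| <= mrank M X.
Proof.
by move=> iI sIX; rewrite (@leq_bigmax_cond _ _ (fun J : {set E} => #|J|)) ?iI.
Qed.

Lemma mrank_le_card X : mrank M X <= #|X|.
Proof. by apply/bigmax_leqP => I /andP[_ /subset_leq_card]. Qed.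

Lemma mrankS A X : A \subset X -> mrank M A <= mrank M X.
Proof.
move=> sAX; apply/bigmax_leqP => I /andP[iI sIA].
exact: indep_le_mrank iI (subset_trans sIA sAX).
Qed.

Lemma mrank_extend I X : indep M I -> I \subset X ->
  exists J, [/\ indep M J, I \subset J, J \subset X & #|J| = mrank M X].
Proof.
move=> iI sIX.
pose P := fun J => [&& indep M J, I \subset J & J \subset X].
have PI : P I by rewrite /P iI subxx sIX.
have [J /maxsetP[/and3P[iJ sIJ sJX] maxJ] _] := maxset_exists PI.
exists J; split=> //; apply/eqP; rewrite eqn_leq indep_le_mrank //=.
apply/bigmax_leqP => J' /andP[iJ' sJ'X]; rewrite leqNgt; apply/negP => ltJ.
have [e /setDP[eJ' eJ] ieJ] := indep_augment iJ iJ' ltJ.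
have PeJ : P (e |: J).
  rewrite /P ieJ (subset_trans sIJ (subsetUr _ _)) subUset sub1set sJX andbT.
  exact: subsetP sJ'X _ eJ'.
by move: eJ; rewrite -(maxJ _ PeJ (subsetUr _ _)) setU11.
Qed.

Lemma mrank_basis X :
  exists J, [/\ indep M J, J \subset X & #|J| = mrank M X].
Proof.
have [J [iJ _ sJX cJ]] := mrank_extend (indep_set0 M) (sub0set X).
by exists J.
Qed.

Lemma mrank_indep I : indep M I -> mrank M I = #|I|.
Proof. by move=> iI; apply/eqP; rewrite eqn_leq mrank_le_card indep_le_mrank. Qed.

(** Reads closure off one maximal independent subset [I] of [X]. A larger independent set in
    [e |: X] would augment [I], and by maximality only by [e] itself. *)
Lemma mem_mcl I X e : indep M I -> I \subset X -> #|I| = mrank M X ->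
  (e \in mcl M X) = (e \in I) || ~~ indep M (e |: I).
Proof.
move=> iI sIX cI; rewrite inE.
have [eI|eI] /= := boolP (e \in I).
  by rewrite (setUidPr _) ?eqxx // sub1set (subsetP sIX).
have [ieI|dI] /= := boolP (indep M (e |: I)).
  apply/negbTE; rewrite neq_ltn; apply/orP; right.
  have := indep_le_mrank ieI (setUS [set e] sIX).
  by rewrite cardsU1 eI cI.
rewrite eqn_leq (mrankS (subsetUr _ _)) andbT -cI.
apply/bigmax_leqP => J /andP[iJ sJ]; rewrite leqNgt; apply/negP => ltJ.
have [f /setDP[fJ fI] ifI] := indep_augment iI iJ ltJ.
have := subsetP sJ _ fJ; rewrite !inE => /orP[/eqP fe|fX].
  by move: dI; rewrite -fe ifI.
have := indep_le_mrank ifI (_ : f |: I \subset X).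
by rewrite subUset sub1set fX sIX cardsU1 fI -cI ltnn => /(_ isT).
Qed.

Lemma sub_mcl X : X \subset mcl M X.
Proof.
by apply/subsetP=> e eX; rewrite inE (setUidPr _) ?eqxx // sub1set.
Qed.

Lemma mclS A X : A \subset X -> mcl M A \subset mcl M X.
Proof.
move=> sAX; apply/subsetP => e.
have [I [iI sIA cI]] := mrank_basis A.
have [J [iJ sIJ sJX cJ]] := mrank_extend iI (subset_trans sIA sAX).
rewrite (mem_mcl _ iI) // (mem_mcl _ iJ) // => /orP[eI|dI].
  by rewrite (subsetP sIJ).
by apply/orP; right; apply: contra dI; apply: indep_subset; rewrite setUS.
Qed.

Lemma mrank_sub_mcl A X : X \subset mcl M A -> mrank M X <= mrank M A.
Proof.
move=> sX; have [I [iI sIA cI]] := mrank_basis A.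
apply/bigmax_leqP => J /andP[iJ sJ]; rewrite -cI leqNgt; apply/negP => ltJ.
have [f /setDP[fJ fI] ifI] := indep_augment iI iJ ltJ.
have := subsetP sX _ (subsetP sJ _ fJ).
by rewrite (mem_mcl _ iI) // (negbTE fI) ifI.
Qed.

(** Idempotence of closure: [A :|: X] has the rank of [A], so an element that does not raise the
    rank of the union does not raise that of [A]. *)
Lemma mcl_sub A X : X \subset mcl M A -> mcl M X \subset mcl M A.
Proof.
move=> sX; apply: subset_trans (mclS (subsetUr A X)) _; apply/subsetP => e.
rewrite !inE => /eqP rk; rewrite eqn_leq (mrankS (subsetUr _ _)) andbT.
apply: leq_trans (mrankS (setUS [set e] (subsetUl A X))) _.
by rewrite rk mrank_sub_mcl // subUset sub_mcl.
Qed.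

Lemma mcl_indepD1 I e : indep M I -> e \in I -> e \notin mcl M (I :\ e).
Proof.
move=> iI eI; have iD := indep_subset (subD1set I e) iI.
by rewrite (mem_mcl _ iD) ?mrank_indep // setD11 setD1K // iI.
Qed.

Lemma circuit_dep C : circuit M C -> ~~ indep M C.
Proof. by case/minsetP. Qed.

Lemma circuit_indepD1 C e : circuit M C -> e \in C -> indep M (C :\ e).
Proof.
case/minsetP => _ minC eC; apply/negPn/negP => /minC/(_ (subD1set _ _)) eq.
by have := setD11 e C; rewrite eq eC.
Qed.

Lemma circuit_neq0 C : circuit M C -> exists e, e \in C.
Proof.
move/circuit_dep => dC; apply/set0Pn; apply: contra dC => /eqP ->.
exact: indep_set0.
Qed.

Lemma dep_circuit X : ~~ indep M X -> exists2 C, circuit M C & C \subset X.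
Proof.
move=> dX; have [C ? ?] := @minset_exists _ (fun Y => ~~ indep M Y) X dX.
by exists C.
Qed.

Lemma circuitI C :
  ~~ indep M C -> (forall e, e \in C -> indep M (C :\ e)) -> circuit M C.
Proof.
move=> dC iC; apply/minsetP; split=> // X dX sXC.
apply/eqP; rewrite eqEsubset sXC; apply/subsetP => e eC.
apply: contraR dX => eX; apply: indep_subset (iC e eC).
by rewrite subsetD1 sXC.
Qed.

Lemma circuit_mcl C e A :
  circuit M C -> e \in C -> C :\ e \subset A -> e \in mcl M A.
Proof.
move=> cC eC sA; apply: (subsetP (mclS sA)).
have iD := circuit_indepD1 cC eC.
by rewrite (mem_mcl _ iD) ?mrank_indep // setD1K // circuit_dep // orbT.
Qed.

Lemma basis_exists : exists B, basis M B.
Proof. by have [B ? _] := maxset_exists (indep_set0 M); exists B. Qed.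

Lemma basis_indep B : basis M B -> indep M B.
Proof. by case/maxsetP. Qed.

Lemma card_basis B : basis M B -> #|B| = mrank M setT.
Proof.
move=> bB; apply/eqP; rewrite eqn_leq indep_le_mrank ?basis_indep //.
by apply/bigmax_leqP => I /andP[iI _]; apply: indep_le_basis iI bB.
Qed.

Lemma mrank_full_basis I : indep M I -> #|I| = mrank M setT -> basis M I.
Proof.
move=> iI cI; apply/maxsetP; split=> // J iJ sIJ.
by apply/esym/eqP; rewrite eqEcard sIJ cI indep_le_mrank.
Qed.

Lemma spanning_basis X : mcl M X = setT -> exists2 B, basis M B & B \subset X.
Proof.
move=> spX; have [B [iB sBX cB]] := mrank_basis X.
exists B => //; apply: mrank_full_basis iB _; apply/eqP.
by rewrite eqn_leq {1}cB mrankS ?subsetT //= cB mrank_sub_mcl // spX.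
Qed.

Lemma basis_spanning B : basis M B -> mcl M B = setT.
Proof.
move=> bB; apply/eqP; rewrite -subTset; apply/subsetP => e _.
rewrite inE eqn_leq (mrankS (subsetUr _ _)) andbT (mrank_indep (basis_indep bB)).
by rewrite (card_basis bB) mrankS.
Qed.

End MatroidTheory.

(** * Orthogonality of circuits and cocircuits, and spanning sets of the dual *)

Section Duality.
Variables (E : finType) (M : matroid E).
Implicit Types (I J B C D A X : {set E}) (e : E).

Lemma coindepP I :
  reflect (exists2 B, basis M B & [disjoint I & B]) (indep (dual M) I).
Proof.
by apply: (iffP existsP) => [[B /andP[]]|[B bB dB]]; exists B => //; rewrite bB.
Qed.

(** Take a maximal coindependent [J] in [A] and a basis [B] avoiding it. If [e] is in [B], exchange:
    a basis inside [(C :\ e) :|: B] that contains [C :\ e] must omit [e], and it still avoids [J]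
    because [C] avoids [A]. So [e |: J] is coindependent. *)
Lemma circuit_notin_dual_mcl C e A : circuit M C -> e \in C ->
  [disjoint C & A] -> e \notin mcl (dual M) A.
Proof.
move=> cC eC dCA; have [J [iJ sJA cJ]] := mrank_basis (dual M) A.
rewrite (mem_mcl _ iJ sJA cJ) negb_or negbK.
have eJ : e \notin J by apply: contraL eC => /(subsetP sJA)/(disjointFl dCA) ->.
rewrite eJ /=; have [B bB dJB] := coindepP _ iJ.
have [eB|eB] := boolP (e \in B); last first.
  by apply/coindepP; exists B => //; rewrite disjointsU1 eB.
have [B' [bB' sCB' sB']] := indep_extend (circuit_indepD1 cC eC) bB.
apply/coindepP; exists B' => //; rewrite disjointsU1; apply/andP; split.
  apply: contra (circuit_dep cC) => eB'; apply: indep_subset (basis_indep bB').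
  by rewrite -(setD1K eC) subUset sub1set eB'.
apply: disjointWr sB' _; rewrite disjoint_sym disjoints_subset subUset.
rewrite -!disjoints_subset [in X in _ && X]disjoint_sym dJB andbT.
exact: disjointW (subD1set _ _) sJA dCA.
Qed.

(** Otherwise [e] would lie in the dual closure of [D :\ e], a set that [C] avoids. *)
Lemma circuit_cocircuit C D e :
  circuit M C -> cocircuit M D -> C :&: D <> [set e].
Proof.
move=> cC cD eq.
have /setIP[eC eD] : e \in C :&: D by rewrite eq set11.
have := circuit_mcl cD eD (subxx _).
apply/negP; apply: circuit_notin_dual_mcl cC eC _.
rewrite -setI_eq0; apply/eqP/setP => f; have /setP/(_ f) := eq.
by rewrite !inE; case: (f == e) => /=; [rewrite andbF|].
Qed.

Lemma basis_meets_cocircuit B D : basis M B -> cocircuit M D -> ~~ [disjoint D & B].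
Proof.
move=> bB cD; apply: contra (circuit_dep cD) => dB.
by apply/coindepP; exists B.
Qed.

(** The bases of the dual are the complements of the bases of [M]: one of them fits inside [~: I]
    exactly when [I] extends to a basis. *)
Lemma indep_dual_spanning I : (mcl (dual M) (~: I) == setT) = indep M I.
Proof.
apply/eqP/idP => [spI|iI].
  have [J /maxsetP[iJ maxJ] sJ] := spanning_basis spI.
  have [B bB dJB] := coindepP _ iJ.
  have iB : indep (dual M) (~: B).
    by apply/coindepP; exists B => //; rewrite disjoints_subset.
  have eqJ : ~: B = J by apply: maxJ => //; rewrite -disjoints_subset.
  apply: indep_subset (basis_indep bB).
  by rewrite -setCS eqJ.
have [B0 bB0] := basis_exists M.
have [B [bB sIB _]] := indep_extend iI bB0.
apply/eqP; rewrite -subTset -setCS in sIB *.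
apply: subset_trans (mclS _ sIB).
rewrite subTset; apply/eqP/basis_spanning/maxsetP; split.
  by apply/coindepP; exists B => //; rewrite disjoints_subset.
move=> J /coindepP[B' bB' dJ] sBJ.
have sB'B : B' \subset B.
  by rewrite -setCS (subset_trans sBJ) // -disjoints_subset.
have eqB : B' = B.
  by apply/eqP; rewrite eqEcard sB'B (card_basis bB) (card_basis bB') leqnn.
by apply/eqP; rewrite eqEsubset sBJ andbT -eqB -disjoints_subset.
Qed.

End Duality.

Lemma exists_card_between (T : finType) (A B : {set T}) k :
  A \subset B -> #|A| <= k <= #|B| ->
  exists Z : {set T}, [/\ A \subset Z, Z \subset B & #|Z| = k].
Proof.
move=> sAB /andP[]; elim: k => [|k IHk] leAk leB.
  by exists A; split=> //; apply/eqP; rewrite -leqn0.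
case: (ltngtP #|A| k.+1) leAk => // [ltA _|eqA _]; last by exists A.
have [Z [sAZ sZB cZ]] := IHk ltA (ltnW leB).
have /subsetPn[x xB xZ] : ~~ (B \subset Z).
  by apply/negP => /subset_leq_card; rewrite cZ leqNgt leB.
exists (x |: Z); split.
- exact: subset_trans sAZ (subsetUr _ _).
- by rewrite subUset sub1set xB.
- by rewrite cardsU1 xZ cZ.
Qed.

(** * Complete subgraphs and stars of K_n as edge sets *)

Definition star (n : nat) (u : 'I_n) (Y : {set 'I_n}) : {set edge n} :=
  [set e : edge n | (u \in val e) && (val e \subset u |: Y)].

Section Edges.
Variable n : nat.
Implicit Types (e f : edge n) (u v x y : 'I_n) (X Y Z : {set 'I_n}).
Implicit Types F : {set edge n}.

Lemma edgeP e : exists u v, u != v /\ val e = [set u; v].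
Proof. by have /cards2P[u [v [uv eq]]] := valP e; exists u, v. Qed.

Lemma edge_exists u v : u != v -> exists e, val e = [set u; v].
Proof.
move=> uv; have c2 : #|[set u; v]| == 2 by rewrite cards2 uv.
by exists (exist (fun e : {set _} => #|e| == 2) _ c2).
Qed.

Lemma edge_at e u : u \in val e -> exists2 v, v != u & val e = [set u; v].
Proof.
have [x [y [xy ->]]] := edgeP e; rewrite !inE => /orP[]/eqP ->.
  by exists y; rewrite 1?eq_sym.
by exists x; rewrite // setUC.
Qed.

Lemma set2_sub u v X : ([set u; v] \subset X) = (u \in X) && (v \in X).
Proof. by rewrite subUset !sub1set. Qed.

Lemma KedgesS X Y : X \subset Y -> Kedges X \subset Kedges Y.
Proof. by move=> sXY; apply/subsetP=> e; rewrite !inE => /subset_trans; apply. Qed.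

Lemma KedgesI X Y : Kedges X :&: Kedges Y = Kedges (X :&: Y).
Proof. by apply/setP=> e; rewrite !inE subsetI. Qed.

Lemma Kedges_val e : Kedges (val e) = [set e].
Proof.
apply/setP=> f; rewrite !inE -val_eqE eqEcard (eqP (valP e)) (eqP (valP f)).
by rewrite andbT.
Qed.

Lemma card_Kedges X : #|Kedges X| = 'C(#|X|, 2).
Proof.
rewrite -(card_imset _ val_inj) -cards_draws; apply: eq_card => A.
rewrite !inE; apply/imsetP/andP => [[e]|[sA cA]].
  by rewrite inE => sX ->; rewrite (valP e).
by exists (exist (fun e : {set _} => #|e| == 2) A cA); rewrite ?inE.
Qed.

Lemma KedgesT : Kedges [set: 'I_n] = setT.
Proof. by apply/setP=> e; rewrite !inE subsetT. Qed.

Lemma starP u Y e : u \notin Y ->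
  reflect (exists2 y, y \in Y & val e = [set u; y]) (e \in star u Y).
Proof.
move=> uY; rewrite inE; apply: (iffP andP) => [[ue]|[y yY ->]].
  have [y yu ->] := edge_at ue; rewrite set2_sub !inE (negbTE yu) eqxx /= => yY.
  by exists y.
by rewrite set2_sub !inE !eqxx yY orbT.
Qed.

Lemma star_sub u Y : star u Y \subset Kedges (u |: Y).
Proof. by apply/subsetP => e; rewrite !inE => /andP[]. Qed.

(** The star is what [Kedges (u |: Y)] has beyond [Kedges Y], so Pascal's rule gives its size. *)
Lemma card_star u Y : u \notin Y -> #|star u Y| = #|Y|.
Proof.
move=> uY; have eqD : star u Y = Kedges (u |: Y) :\: Kedges Y.
  apply/setP=> e; rewrite !inE; case: (boolP (_ \subset u |: Y)) => // [s|];
    rewrite ?andbF //= !andbT.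
  apply/idP/idP => [ue|]; first by apply: contra uY => /subsetP/(_ u); apply.
  apply: contraR => ue; apply/subsetP => x xe; have := subsetP s x xe.
  by rewrite !inE => /orP[/eqP xu|//]; rewrite xu in xe; rewrite xe in ue.
have := cardsID (Kedges Y) (Kedges (u |: Y)).
rewrite (setIidPr (KedgesS (subsetUr _ _))) -eqD !card_Kedges cardsU1 uY.
by rewrite add1n binS bin1 => /addnI.
Qed.

Lemma verts_sub F X : (verts F \subset X) = (F \subset Kedges X).
Proof.
apply/bigcupsP/subsetP => [sF e eF|sF e eF]; first by rewrite inE sF.
by have := sF e eF; rewrite inE.
Qed.

Lemma sub_Kedges_verts F : F \subset Kedges (verts F).
Proof. by rewrite -verts_sub. Qed.

Lemma verts_setU F1 F2 : verts (F1 :|: F2) = verts F1 :|: verts F2.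
Proof.
apply/eqP; rewrite eqEsubset subUset !verts_sub.
rewrite subUset -!verts_sub subsetUl subsetUr /=.
apply/andP; split; apply/bigcupsP => e eF; apply: bigcup_sup;
  by rewrite inE eF ?orbT.
Qed.

Lemma verts_Kedges X : 1 < #|X| -> verts (Kedges X) = X.
Proof.
move=> c2; apply/eqP; rewrite eqEsubset verts_sub subxx /=.
apply/subsetP => x xX; have /card_gt0P[y] : 0 < #|X :\ x|.
  by rewrite (cardsD1 x) xX in c2.
rewrite !inE => /andP[yx yX]; have [e ee] := edge_exists yx.
apply/bigcupP; exists e; first by rewrite inE ee set2_sub yX.
by rewrite ee !inE eqxx orbT.
Qed.

Lemma complete_graph_copy k F :
  is_copy (complete_graph k) F <->
  exists2 X : {set 'I_n}, #|X| = k & F = Kedges X.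
Proof.
split=> [[f inj_f ->]|[X <- ->]].
  exists (f @: setT); first by rewrite card_imset // cardsT card_ord.
  apply/setP => e; rewrite !inE; apply/existsP/idP.
    case=> x /existsP[y /andP[_ /eqP ->]].
    by rewrite set2_sub !imset_f ?inE.
  have [u [v [uv ->]]] := edgeP e.
  rewrite set2_sub => /andP[/imsetP[x _ ux] /imsetP[y _ vy]].
  exists x; apply/existsP; exists y; rewrite ux vy eqxx andbT.
  by apply: contra uv => /eqP xy; rewrite ux vy xy.
exists (@enum_val _ (mem X)); first exact: enum_val_inj.
apply/setP => e; rewrite !inE; apply/idP/existsP; last first.
  by case=> x /existsP[y /andP[_ /eqP ->]]; rewrite set2_sub !enum_valP.
have [u [v [uv ->]]] := edgeP e; rewrite set2_sub => /andP[uX vX].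
exists (enum_rank_in uX u); apply/existsP; exists (enum_rank_in uX v).
rewrite !enum_rankK_in // eqxx andbT; apply: contra uv => /eqP eq.
by rewrite -(enum_rankK_in uX uX) eq enum_rankK_in.
Qed.

Lemma complete_bipartite1_copy k F :
  is_copy (complete_bipartite 1 k) F <->
  exists (u : 'I_n) (Y : {set 'I_n}), [/\ u \notin Y, #|Y| = k & F = star u Y].
Proof.
split=> [[f inj_f ->]|[u [Y [uY <- ->]]]].
  have uY : f (inl ord0) \notin [set f (inr i) | i : 'I_k].
    by apply/imsetP => -[i _ /inj_f].
  exists (f (inl ord0)), [set f (inr i) | i : 'I_k]; split=> //.
    by rewrite card_imset ?card_ord // => i j /inj_f[].
  apply/setP => e; apply/idP/starP => //; last first.
    case=> y /imsetP[i _ ->] ee; rewrite inE.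
    by apply/existsP; exists (inl ord0); apply/existsP; exists (inr i); rewrite /= ee.
  rewrite inE => /existsP[[i|i] /existsP[[j|j] /andP[//= _ /eqP ->]]].
    by exists (f (inr j)); rewrite ?imset_f // ord1.
  by exists (f (inr i)); rewrite ?imset_f // ord1 setUC.
pose f (z : 'I_1 + 'I_#|Y|) := if z is inr i then enum_val i else u.
have fY i : f (inr i) \in Y by apply: enum_valP.
exists f.
  case=> [i|i] [j|j] //= eq; first by rewrite (ord1 i) (ord1 j).
  - by move: uY; rewrite eq enum_valP.
  - by move: uY; rewrite -eq enum_valP.
  - by rewrite (enum_val_inj eq).
apply/setP => e; apply/starP/idP => // [[y yY ee]|]; rewrite inE.
  apply/existsP; exists (inl ord0); apply/existsP.
  by exists (inr (enum_rank_in yY y)); rewrite /= enum_rankK_in // ee.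
case/existsP=> [[i|i] /existsP[[j|j] /andP[//= _ /eqP ->]]].
  by exists (enum_val j); rewrite ?enum_valP.
by exists (enum_val i); rewrite ?enum_valP // setUC.
Qed.

End Edges.

(** * What (R2) and (R3) say about complete subgraphs *)

Section DualRigidity.
Variables (n t : nat) (M : matroid (edge n)).
Implicit Types (e f : edge n) (u v x y : 'I_n) (X Y Z : {set 'I_n}).
Implicit Types (C A F : {set edge n}).

Lemma R2starP :
  R2star t M <-> forall Z, #|Z| = (n - t).+1 -> cocircuit M (Kedges Z).
Proof.
split=> [R2 Z cZ|R2 F /complete_graph_copy[Z cZ ->]]; last exact: R2.
by apply: R2; apply/complete_graph_copy; exists Z.
Qed.

Lemma R2star_circuit Z :
  R2star t M -> #|Z| = (n - t).+1 -> circuit (dual M) (Kedges Z).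
Proof. by move/R2starP => R2 /R2. Qed.

Lemma R3starP :
  R3star t M <->
  forall u Y, u \notin Y -> #|Y| = t.+1 -> circuit M (star u Y).
Proof.
split=> [R3 u Y uY cY|R3 F /complete_bipartite1_copy[u [Y [uY cY ->]]]].
  by apply: R3; apply/complete_bipartite1_copy; exists u, Y.
exact: R3.
Qed.

Lemma card_setCU X Y : Y \subset X -> #|~: X :|: Y| = n - #|X| + #|Y|.
Proof.
move=> sYX; rewrite cardsU cardsCs setCK card_ord (_ : _ :&: _ = set0) ?cards0 ?subn0 //.
by apply/eqP; rewrite setI_eq0 disjoint_sym disjoints_subset setCK.
Qed.

(** Orthogonality localised to [X]: the cocircuit on the vertex set [~: X :|: Y] meets [Kedges X]
    exactly in [Kedges Y]. *)
Lemma circuit_Kedges_trace X Y C e : R2star t M -> circuit M C ->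
  C \subset Kedges X -> Y \subset X -> n - #|X| + #|Y| = (n - t).+1 ->
  C :&: Kedges Y <> [set e].
Proof.
move=> R2 cC sCX sYX; rewrite -card_setCU // => /(R2star_circuit R2) cD.
have := @circuit_cocircuit _ _ _ _ e cC cD.
rewrite -{1}(setIidPl sCX) -setIA KedgesI setIUr setICr set0U.
by rewrite (setIidPr sYX).
Qed.

Lemma indep_Kedges X :
  t < n -> R2star t M -> #|X| = t.+1 -> indep M (Kedges X).
Proof.
move=> lt_tn R2 cX; apply/negPn/negP => /dep_circuit[C cC sCX].
have [e eC] := circuit_neq0 cC.
have sX : val e \subset X by have := subsetP sCX e eC; rewrite inE.
apply: (@circuit_Kedges_trace X (val e) C e) => //; last first.
  by rewrite Kedges_val (setIidPr _) // sub1set.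
by rewrite cX (eqP (valP e)); lia.
Qed.

Lemma star_mcl u Y e (A : {set edge n}) : R3star t M ->
  u \notin Y -> #|Y| = t.+1 -> e \in star u Y ->
  star u Y :\ e \subset mcl M A -> e \in mcl M A.
Proof.
move=> /R3starP R3 uY cY eS sS; apply: (subsetP (mcl_sub (subxx _))).
exact: circuit_mcl (R3 u Y uY cY) eS sS.
Qed.

Lemma Kedges_spanning X : R3star t M -> #|X| = t.+1 -> mcl M (Kedges X) = setT.
Proof.
move=> R3 cX.
(* First pass, edges [uv] with [v] in [X] and [u] outside: in the star at [v] with leaves [u] and
   [X :\ v], every other edge lies in [Kedges X]. *)
have touch e v : v \in val e -> v \in X -> e \in mcl M (Kedges X).
  move=> ve vX; have [u uv ee] := edge_at ve.
  have [uX|uX] := boolP (u \in X).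
    by rewrite (subsetP (sub_mcl _ _)) // inE ee set2_sub vX.
  have vY : v \notin u |: X :\ v by rewrite !inE eqxx eq_sym (negbTE uv).
  apply: (star_mcl R3 vY).
  - by rewrite cardsU1 !inE (negbTE uX) andbF -cX [in RHS](cardsD1 v) vX.
  - by apply/starP => //; exists u; rewrite // setU11.
  apply/subsetP => f /setD1P[fe /(starP _ vY)[w]]; rewrite 3!inE => wY ef.
  rewrite (subsetP (sub_mcl _ _)) // inE ef set2_sub vX /=.
  case/orP: wY => [/eqP wu|/andP[] //].
  by move: fe; rewrite -val_eqE /= ef wu -ee eqxx.
apply/eqP; rewrite -subTset; apply/subsetP => e _.
have [u [v [uv ee]]] := edgeP e.
have [uX|uX] := boolP (u \in X); first by apply: touch uX; rewrite ee !inE eqxx.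
have [vX|vX] := boolP (v \in X); first by apply: touch vX; rewrite ee !inE eqxx orbT.
(* Second pass, both ends outside [X]: in the star at [u] with leaves [v] and [t] vertices of [X],
   every other edge is covered by [touch]. *)
have /card_gt0P[x xX] : 0 < #|X| by rewrite cX.
have uY : u \notin v |: X :\ x by rewrite !inE (negbTE uv) (negbTE uX) andbF.
apply: (star_mcl R3 uY).
- by rewrite cardsU1 !inE (negbTE vX) andbF -cX [in RHS](cardsD1 x) xX.
- by apply/starP => //; exists v; rewrite // setU11.
apply/subsetP => f /setD1P[fe /(starP _ uY)[w]]; rewrite 3!inE => wY ef.
case/orP: wY => [/eqP wv|/andP[_ wX]].
  by move: fe; rewrite -val_eqE /= ef wv -ee eqxx.
by apply: touch wX; rewrite ef !inE eqxx orbT.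
Qed.

(** * Any two of the three properties imply the third *)

Lemma R2_R3_R1 : t < n -> R2star t M -> R3star t M -> R1star t M.
Proof.
move=> lt_tn R2 R3.
have [|X [_ _ cX]] := @exists_card_between _ (set0 : {set 'I_n}) setT t.+1 (sub0set _).
  by rewrite cards0 cardsT card_ord.
rewrite /R1star -cX -card_Kedges; apply/eqP; rewrite eqn_leq.
rewrite (indep_le_mrank (indep_Kedges lt_tn R2 cX)) ?subsetT // andbT.
apply: leq_trans (mrank_le_card M _); apply: mrank_sub_mcl.
by rewrite Kedges_spanning.
Qed.

(** Minimality is automatic: for an edge [e] of [Kedges Z], the set [~: Z :|: val e] has t + 1
    vertices, so its complete graph contains a basis, and that basis can meet [Kedges Z] only in
    [e]. *)
Lemma R3_codependent_R2 : t < n -> R3star t M ->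
  (forall Z, #|Z| = (n - t).+1 -> ~~ indep (dual M) (Kedges Z)) -> R2star t M.
Proof.
move=> lt_tn R3 dZ; apply/R2starP => Z cZ; apply: circuitI (dZ Z cZ) _ => e.
rewrite inE => sZ; have leZ : #|Z| <= n by rewrite -[leqRHS]card_ord max_card.
have cX : #|~: Z :|: val e| = t.+1.
  by rewrite card_setCU // (eqP (valP e)) cZ; lia.
have [B bB sBX] := spanning_basis (Kedges_spanning R3 cX).
apply/coindepP; exists B => //; apply: disjointWr sBX _.
rewrite disjoints_subset; apply/subsetP => f /setD1P[fe].
rewrite !inE => fZ; apply: contra fe => fX.
have : f \in Kedges (Z :&: (~: Z :|: val e)) by rewrite inE subsetI fZ.
by rewrite setIUr setICr set0U (setIidPr sZ) Kedges_val inE.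
Qed.

Lemma R1_R3_R2 : t < n -> R1star t M -> R3star t M -> R2star t M.
Proof.
move=> lt_tn R1 R3; apply: R3_codependent_R2 => // Z cZ.
have leZ : #|Z| <= n by rewrite -[leqRHS]card_ord max_card.
apply/negP => /coindepP[B bB dB].
have /card_gt0P[z1 z1Z] : 0 < #|Z| by rewrite cZ.
have /card_gt0P[z2] : 0 < #|Z :\ z1|.
  by have := cardsD1 z1 Z; rewrite z1Z cZ; lia.
rewrite !inE => /andP[z21 z2Z]; have [e ee] := edge_exists z21.
have eZ : val e \subset Z by rewrite ee set2_sub z2Z.
pose X := ~: Z :|: val e.
have cX : #|X| = t.+1 by rewrite card_setCU // (eqP (valP e)) cZ; lia.
have eX : e \in Kedges X by rewrite inE subsetUr.
(* [Kedges X :\ e] has one edge fewer than the rank, so it cannot span the basis [B]. *)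
suff sB : B \subset mcl M (Kedges X :\ e).
  have := mrank_sub_mcl sB.
  rewrite (mrank_indep (basis_indep bB)) (card_basis bB) R1.
  move=> /leq_trans/(_ (mrank_le_card _ _)).
  have := cardsD1 e (Kedges X); rewrite eX card_Kedges cX => ->; rewrite add1n ltnn //.
(* Each edge of [B] has an end [w] outside [Z]. As [e] lies inside [Z], the star circuits at [w]
   avoid [e], so [f] is closed up without it. *)
apply/subsetP => f fB; have : f \notin Kedges Z by rewrite (disjointFl dB).
rewrite inE => /subsetPn[w wf wZ]; have [z zw ef] := edge_at wf.
have notat (g : edge n) : w \in val g -> g != e.
  by move=> wg; apply: contra wZ => /eqP ge; rewrite (subsetP eZ) // -ge.
have wX : w \in X by rewrite !inE wZ.
have [zX|zX] := boolP (z \in X).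
  by rewrite (subsetP (sub_mcl _ _)) // !inE notat // ef set2_sub wX.
have wY : w \notin z |: X :\ w by rewrite in_setU1 setD11 eq_sym (negbTE zw).
apply: (star_mcl R3 wY).
- by rewrite cardsU1 in_setD1 (negbTE zX) andbF -cX [in RHS](cardsD1 w) wX.
- by apply/starP => //; exists z; rewrite // setU11.
apply/subsetP => g /setD1P[gf /(starP _ wY)[x xY eg]].
rewrite (subsetP (sub_mcl _ _)) // in_setD1 notat ?eg ?set21 //.
rewrite inE eg set2_sub wX /=.
move: xY; rewrite in_setU1 in_setD1 => /orP[/eqP xz|/andP[] //].
by move: gf; rewrite -val_eqE /= eg xz -ef eqxx.
Qed.

(** A star less one edge lies in an independent K_{t+1}. If the whole star were independent, it
    would extend by edges of the basis [Kedges X] to a basis [B] missing some edge [e] of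
    [Kedges X]; the cocircuit built from [e] and the leaf [y0] then avoids [B]. *)
Lemma R1_R2_R3 : t < n -> R1star t M -> R2star t M -> R3star t M.
Proof.
move=> lt_tn R1 R2; apply/R3starP => u Y uY cY.
have cuY : #|u |: Y| = t.+2 by rewrite cardsU1 uY cY.
apply: circuitI => [|f fS]; last first.
  have [y yY ef] := starP _ uY fS.
  apply: indep_subset (indep_Kedges (X := u |: Y :\ y) lt_tn R2 _).
    apply/subsetP => g /setD1P[gf /(starP _ uY)[x xY eg]].
    rewrite inE eg set2_sub setU11 in_setU1 in_setD1 xY andbT.
    by apply/orP; right; apply: contra gf => /eqP xy; rewrite -val_eqE /= eg ef xy.
  by rewrite cardsU1 !inE (negbTE uY) andbF -cY [in RHS](cardsD1 y) yY.
apply/negP => iS.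
have /card_gt0P[y0 y0Y] : 0 < #|Y| by rewrite cY.
have y0u : y0 != u by apply: contra uY => /eqP <-.
pose X := u |: Y :\ y0.
have cX : #|X| = t.+1.
  by rewrite cardsU1 !inE (negbTE uY) andbF -cY [in RHS](cardsD1 y0) y0Y.
have y0X : y0 \notin X by rewrite !inE eqxx (negbTE y0u).
have sXuY : X \subset u |: Y by rewrite setUS // subD1set.
have bX : basis M (Kedges X).
  by apply: mrank_full_basis (indep_Kedges lt_tn R2 cX) _; rewrite R1 card_Kedges cX.
have [B [bB sSB sB]] := indep_extend iS bX.
have [e0 ee0] := edge_exists y0u.
have e0S : e0 \in star u Y by apply/starP => //; exists y0; rewrite // setUC.
have /subsetPn[e eX eB] : ~~ (Kedges X \subset B).
  apply/negP => sXB; have eqB : Kedges X = B.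
    by apply/eqP; rewrite eqEcard sXB (card_basis bX) (card_basis bB) leqnn.
  have := subsetP sSB e0 e0S.
  by rewrite -eqB inE ee0 set2_sub (negbTE y0X).
rewrite inE in eX.
have ue : u \notin val e.
  apply: contra eB => ue; apply: (subsetP sSB).
  by rewrite inE ue (subset_trans eX sXuY).
(* Star edges contain [u], which is not in this triangle, and edges of [Kedges X] avoid [y0]. *)
have sBe : B :&: Kedges (y0 |: val e) \subset [set e].
  rewrite -Kedges_val; apply/subsetP => f /setIP[fB]; rewrite !inE => fe.
  have /setUP[fS|fX] := subsetP sB f fB.
    have [y yY ef] := starP _ uY fS; move: fe.
    rewrite ef set2_sub in_setU1 (negbTE ue) eq_sym (negbTE y0u) => /andP[] //.
  apply/subsetP => x xf; have := subsetP fe x xf; rewrite in_setU1.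
  case/orP=> // /eqP xy0; move: fX; rewrite inE => /subsetP/(_ x xf).
  by rewrite xy0 (negbTE y0X).
have sy0e : y0 |: val e \subset u |: Y.
  by rewrite subUset sub1set !inE y0Y orbT (subset_trans eX sXuY).
have y0e : y0 \notin val e by apply: contra y0X => /(subsetP eX).
have le_tn : t.+2 <= n by rewrite -cuY -[leqRHS]card_ord max_card.
have cD : #|~: (u |: Y) :|: (y0 |: val e)| = (n - t).+1.
  rewrite card_setCU // cuY cardsU1 y0e (eqP (valP e)) add1n.
  by clear -le_tn; lia.
apply/negP: (basis_meets_cocircuit bB (R2star_circuit R2 cD)).
rewrite negbK.
rewrite disjoint_sym -setI_eq0 -subset0; apply/subsetP => f /setIP[fB fK].
have fuY : f \in Kedges (u |: Y).
  apply: (subsetP _ f (subsetP sB f fB)).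
  by rewrite subUset star_sub KedgesS.
have fI : f \in Kedges (y0 |: val e).
  rewrite -(setIidPr sy0e) -[_ :&: _]set0U -(setICr (u |: Y)) -setIUr -KedgesI.
  by rewrite inE fuY.
have : f \in [set e] by rewrite (subsetP sBe) // inE fB.
by rewrite inE => /eqP fe; rewrite -fe fB in eB.
Qed.

(** * Rigidity of the dual from (R1) and (R2) *)

(* Removing from [K_(U :|: V)] the double star [T] with centres [u] and [v], but
   not [uv] itself, leaves one edge more than the rank, hence a circuit. No circuit
   in [K_(U :|: V)] meets a triangle in exactly one edge, so this one avoids [K_U]
   and [K_V] and contains [uv]. *)
Lemma bond_circuit (U V : {set 'I_n}) u v e : R1star t M -> R2star t M ->
  [disjoint U & V] -> #|U :|: V| = t.+2 -> u \in U -> v \in V ->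
  val e = [set u; v] ->
  exists C, [/\ circuit M C, e \in C &
    forall f, f \in C -> exists x y, [/\ x \in U, y \in V & val f = [set x; y]]].
Proof.
move=> R1 R2 dUV cUV uU vV ee; pose X := U :|: V.
have le_tn : t.+2 <= n by rewrite -cUV -[leqRHS]card_ord max_card.
pose T := star u (U :\ u) :|: star v (V :\ v).
have dQ : ~~ indep M (Kedges X :\: T).
  have cT : #|T| <= t.
    apply: leq_trans (leq_card_setU _ _) _; rewrite !card_star ?setD11 //.
    have := cardsUI U V; rewrite (disjoint_setI0 dUV) cards0 cUV addn0.
    by rewrite (cardsD1 u U) (cardsD1 v V) uU vV !add1n addSn addnS => -[->].
  apply/negP => iQ; have := indep_le_mrank iQ (subsetT _).
  rewrite R1 leqNgt -(ltn_add2l #|Kedges X :&: T|) cardsID card_Kedges cUV.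
  (* Pascal's rule: C(t+2, 2) exceeds the rank C(t+1, 2) by t + 1, while [T] has at most t edges. *)
  rewrite (binS t.+1) bin1 [ltnLHS]addnC ltn_add2l ltnS (leq_trans _ cT) //.
  exact: subset_leq_card (subsetIr _ _).
have [C cC sC] := dep_circuit dQ.
have sCX : C \subset Kedges X := subset_trans sC (subsetDl _ _).
pose a x y := [set x; y] \in [set val f | f in C].
have aC x y : a x y = a y x by rewrite /a setUC.
have aP f x y : val f = [set x; y] -> (f \in C) = a x y.
  move=> ef; apply/idP/imsetP => [fC|[g gC]]; first by exists f.
  by rewrite -ef => /val_inj ->.
have a_irr x : ~~ a x x.
  apply/imsetP => -[f _ ef]; have := valP f; rewrite /= -ef setUid cards1 //.
have aX x y : a x y -> (x \in X) && (y \in X).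
  by case/imsetP=> f /(subsetP sCX); rewrite inE => + ef; rewrite -ef set2_sub.
have triangle x y z : z \in X -> a x y -> a x z || a y z.
  move=> zX axy; have [->|zx] := eqVneq z x; first by rewrite (aC y) axy orbT.
  have [->|zy] := eqVneq z y; first by rewrite axy.
  have xy : x != y by apply: contraTneq axy => ->.
  apply/negPn/negP; rewrite negb_or => /andP[nxz nyz].
  have /andP[xX yX] := aX _ _ axy; have [f ef] := edge_exists xy.
  apply: (@circuit_Kedges_trace X (z |: [set x; y]) C f) => //.
  - by rewrite subUset sub1set zX set2_sub xX.
  - by rewrite cUV cardsU1 !inE negb_or zx zy cards2 xy /=; clear -le_tn; lia.
  apply/setP => g; rewrite in_set1; apply/setIP/eqP => [[gC]|->]; last first.
    by rewrite (aP _ _ _ ef) axy inE ef subsetUr.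
  have [p [q [pq eg]]] := edgeP g; move: gC; rewrite (aP _ _ _ eg) => apq.
  rewrite inE eg set2_sub !inE => /andP[/or3P[]/eqP Ep /or3P[]/eqP Eq];
    apply: val_inj; rewrite /= eg ef Ep Eq //; move: apq pq; rewrite Ep Eq;
    by rewrite ?eqxx // 1?setUC 1?[a z _]aC ?(negbTE nxz) ?(negbTE nyz).
have uX : u \in X by rewrite inE uU.
have vX : v \in X by rewrite inE vV orbT.
have notT f : f \in C -> f \notin T by move=> /(subsetP sC)/setDP[].
have nau x : x \in U -> ~~ a u x.
  move=> xU; have [->//|xu] := eqVneq x u.
  rewrite eq_sym in xu; have [f ef] := edge_exists xu.
  rewrite -(aP _ _ _ ef); apply/negP => /notT/negP; apply.
  by apply/setUP; left; apply/starP; rewrite ?setD11 //; exists x; rewrite // !inE eq_sym xu.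
have nav x : x \in V -> ~~ a v x.
  move=> xV; have [->//|xv] := eqVneq x v.
  rewrite eq_sym in xv; have [f ef] := edge_exists xv.
  rewrite -(aP _ _ _ ef); apply/negP => /notT/negP; apply.
  by apply/setUP; right; apply/starP; rewrite ?setD11 //; exists x; rewrite // !inE eq_sym xv.
(* An edge of [C] inside [U] would form with [u] a triangle meeting [C] only in that edge, since [C]
   has no edge from [u] into [U]. *)
have bip x y : a x y -> x \in U -> y \in V.
  move=> axy xU; have /andP[_] := aX _ _ axy; rewrite inE => /orP[yU|//].
  have := triangle x y u uX axy.
  by rewrite !(aC _ u) (negbTE (nau _ _)) // (negbTE (nau _ _)).
have bip' x y : a x y -> x \in V -> y \in U.
  move=> axy xV; have /andP[_] := aX _ _ axy; rewrite inE => /orP[//|yV].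
  have := triangle x y v vX axy.
  by rewrite !(aC _ v) (negbTE (nav _ _)) // (negbTE (nav _ _)).
have bipC f : f \in C -> exists x y, [/\ x \in U, y \in V & val f = [set x; y]].
  move=> fC; have [x [y [_ ef]]] := edgeP f.
  have axy : a x y by rewrite -(aP _ _ _ ef).
  have /andP[/setUP[xU|xV] _] := aX _ _ axy.
    by exists x, y; rewrite (bip x y).
  by exists y, x; rewrite (bip' x y) // setUC.
exists C; split=> //; rewrite (aP _ _ _ ee); apply: contraT => nuv.
(* Without [uv], the triangles [u y v] leave no edge of [C] at [u]; then any edge of [C] spans with
   [u] a forbidden triangle. *)
have nauV y : y \in V -> ~~ a u y.
  move=> yV; apply/negP => auy; have := triangle u y v vX auy.
  by rewrite (negbTE nuv) aC (negbTE (nav _ _)).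
have [f fC] := circuit_neq0 cC; have [x [y [xU yV ef]]] := bipC f fC.
have := triangle x y u uX; rewrite -(aP _ _ _ ef) => /(_ fC).
by rewrite !(aC _ u) (negbTE (nau _ _)) // (negbTE (nauV _ _)).
Qed.

Lemma bond_notin_dual_mcl (U V : {set 'I_n}) u v e A :
  R1star t M -> R2star t M -> [disjoint U & V] -> t.+2 <= #|U :|: V| ->
  u \in U -> v \in V -> val e = [set u; v] ->
  (forall f x y, f \in A -> val f = [set x; y] -> x \in U -> y \notin V) ->
  e \notin mcl (dual M) A.
Proof.
move=> R1 R2 dUV leUV uU vV ee nA.
have uv : u != v by apply: contraTneq uU => ->; rewrite (disjointFl dUV).
have [||Z [sZ sZUV cZ]] := @exists_card_between _ [set u; v] (U :|: V) t.+2.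
- by rewrite set2_sub !inE uU vV orbT.
- by rewrite cards2 uv.
move: sZ; rewrite set2_sub => /andP[uZ vZ].
have [||||C [cC eC bC]] := @bond_circuit (U :&: Z) (V :&: Z) u v e R1 R2 _ _ _ _ ee.
- exact: disjointW (subsetIl _ _) (subsetIl _ _) dUV.
- by rewrite -setIUl (setIidPr sZUV).
- by rewrite inE uU.
- by rewrite inE vV.
apply: circuit_notin_dual_mcl cC eC _; rewrite -setI_eq0 -subset0.
apply/subsetP => f /setIP[/bC[x [y [/setIP[xU _] /setIP[yV _] ef]]] fA].
by have := nA f x y fA ef xU; rewrite yV.
Qed.

Lemma dual_mcl_setU F1 F2 : R1star t M -> R2star t M ->
  #|verts F1 :&: verts F2| < n - t - 1 ->
  mcl (dual M) (F1 :|: F2) \subset Kedges (verts F1) :|: Kedges (verts F2).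
Proof.
move=> R1 R2 ltd; apply/subsetP => e; apply: contraLR.
have lt_tn : t.+1 < n by lia.
have inF x y f : f \in F1 :|: F2 -> val f = [set x; y] ->
    (x \in verts F1) && (y \in verts F1) || (x \in verts F2) && (y \in verts F2).
  move=> fF ef; rewrite -!set2_sub -ef.
  by case/setUP: fF => /(subsetP (sub_Kedges_verts _)); rewrite inE => ->; rewrite ?orbT.
have isolated u v : u != v -> val e = [set u; v] -> v \notin verts F1 :|: verts F2 ->
    e \notin mcl (dual M) (F1 :|: F2).
  move=> uv ee; rewrite inE negb_or => /andP[v1 v2].
  apply: (bond_notin_dual_mcl (U := ~: [set v]) (V := [set v])) ee _ => //.
  - by rewrite disjoints_subset.
  - by rewrite setUC setUCr cardsT card_ord.
  - by rewrite !inE.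
  - by rewrite inE.
  move=> f x y fF ef _; rewrite inE; apply: contraNneq v1 => yv; subst y.
  by case/orP: (inF _ _ _ fF ef) => /andP[_] //; rewrite (negbTE v2).
(* The two sides together form the complement of [verts F1 :&: verts F2], which has at least t + 2
   vertices; an edge between them lies in neither complete graph. *)
have separated u v : val e = [set u; v] -> u \notin verts F2 ->
    v \in verts F2 -> v \notin verts F1 -> e \notin mcl (dual M) (F1 :|: F2).
  move=> ee u2 v2 v1.
  apply: (bond_notin_dual_mcl (U := ~: verts F2) (V := verts F2 :\: verts F1)) ee _ => //.
  - by rewrite disjoint_sym disjoints_subset setCK subsetDl.
  - rewrite setDE setUIr setUC setUCr setTI -setCI cardsCs setCK card_ord setIC.
    by clear -ltd; lia.
  - by rewrite inE.
  - by rewrite inE v1.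
  move=> f x y fF ef; rewrite !inE => x2; apply/negP => /andP[y1 _].
  by have := inF _ _ _ fF ef; rewrite (negbTE x2) (negbTE y1) andbF.
have [u [v [uv ee]]] := edgeP e;
rewrite in_setU ![e \in Kedges _]inE negb_or ee !set2_sub.
have ee' : val e = [set v; u] by rewrite setUC.
have [vF|/(isolated _ _ uv ee)//] := boolP (v \in verts F1 :|: verts F2).
rewrite eq_sym in uv.
have [uF|/(isolated _ _ uv ee')//] := boolP (u \in verts F1 :|: verts F2).
case/setUP: uF => [u1|u2].
  rewrite u1 /= => /andP[v1 n2]; move: vF; rewrite inE (negbTE v1) /= => v2.
  by apply: (separated u v ee _ v2 v1); move: n2; rewrite v2 andbT.
rewrite u2 /= => /andP[n1 v2]; move: vF; rewrite inE (negbTE v2) orbF => v1.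
by apply: (separated v u ee' v2 u2); move: n1; rewrite v1 andbT.
Qed.

(** For (G2), an edge joining [verts F1] to [verts F2] completes a circuit K_{n-t+1} of the dual on
    its two ends and n - t - 1 common vertices. The reverse inclusion is (G1) with an empty second
    set. *)
Lemma R1_R2_abstract_rigidity : t < n -> R1star t M -> R2star t M ->
  abstract_rigidity (n - t - 1) (dual M).
Proof.
move=> lt_tn R1 R2; split=> [|F1 F2|F1 F2 cl1 cl2 led]; first by lia.
  exact: dual_mcl_setU.
have sK1 : Kedges (verts F1) \subset mcl (dual M) (F1 :|: F2).
  by rewrite -cl1 mclS ?subsetUl.
have sK2 : Kedges (verts F2) \subset mcl (dual M) (F1 :|: F2).
  by rewrite -cl2 mclS ?subsetUr.
apply/eqP; rewrite eqEsubset; apply/andP; split; last first.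
  have cross e u v : val e = [set u; v] -> u \in verts F1 -> u \notin verts F2 ->
      v \in verts F2 -> v \notin verts F1 -> e \in mcl (dual M) (F1 :|: F2).
    move=> ee u1 u2 v2 v1.
    have [|S [_ sS cS]] := @exists_card_between _ (set0 : {set 'I_n})
        (verts F1 :&: verts F2) (n - t - 1) (sub0set _).
      by rewrite cards0.
    move: sS; rewrite subsetI => /andP[s1 s2].
    have uS : u \notin v |: S.
      rewrite in_setU1 negb_or (contra ((subsetP s2) u)) // andbT.
      by apply: contraNneq u2 => ->.
    have cZ : #|u |: (v |: S)| = (n - t).+1.
      rewrite cardsU1 uS cardsU1 (contra ((subsetP s1) v)) // cS.
      by clear -lt_tn; lia.
    have eZ : e \in Kedges (u |: (v |: S)) by rewrite inE ee set2_sub !inE !eqxx orbT.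
    apply: (subsetP (mcl_sub (subxx _))).
    apply: circuit_mcl (R2star_circuit R2 cZ) eZ _.
    apply/subsetP => f /setD1P[fe]; rewrite inE => sf.
    have [uf|uf] := boolP (u \in val f).
      apply: (subsetP sK1); rewrite inE; apply/subsetP => x xf.
      have := subsetP sf x xf; rewrite !in_setU1 => /or3P[/eqP->//|/eqP xv|]; last first.
        exact: subsetP s1 x.
      have [w _ ef] := edge_at uf; move: xf fe; rewrite ef xv !inE.
      case/orP=> [/eqP vu|/eqP vw]; first by move: u2; rewrite -vu v2.
      by rewrite -val_eqE /= ef ee vw eqxx.
    apply: (subsetP sK2); rewrite inE; apply/subsetP => x xf.
    have := subsetP sf x xf; rewrite !in_setU1 => /or3P[/eqP xu|/eqP->//|].
      by rewrite xu in xf; rewrite xf in uf.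
    exact: subsetP s2 x.
  apply/subsetP => e; have [u [v [_ ee]]] := edgeP e.
  rewrite inE verts_setU ee set2_sub.
  have [e1|] := boolP (val e \subset verts F1).
    by rewrite (subsetP sK1) // inE.
  have [e2|] := boolP (val e \subset verts F2).
    by rewrite (subsetP sK2) // inE.
  rewrite ee !set2_sub !in_setU.
  have ee' : val e = [set v; u] by rewrite setUC.
  have [u1|u1] := boolP (u \in verts F1); have [u2|u2] := boolP (u \in verts F2);
    have [v1|v1] := boolP (v \in verts F1); have [v2|v2] := boolP (v \in verts F2) => //.
    by rewrite (cross e u v).
  by rewrite (cross e v u).
have [d0|d_gt0] := posnP (n - t - 1).
  have full : mcl (dual M) F1 = setT.
    apply/eqP; rewrite -subTset; apply/subsetP => e _.
    have cZ : #|val e| = (n - t).+1 by rewrite (eqP (valP e)); clear -d0 lt_tn; lia.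
    apply: circuit_mcl (R2star_circuit R2 cZ) _ _; rewrite Kedges_val ?set11 //.
    by rewrite setDv sub0set.
  rewrite verts_setU; apply: subset_trans (subsetT _) _.
  by rewrite -full cl1 KedgesS ?subsetUl.
have v0 : verts (set0 : {set edge n}) = set0 by rewrite /verts big_set0.
have := @dual_mcl_setU (F1 :|: F2) set0 R1 R2.
rewrite setU0 v0 setI0 cards0 => /(_ d_gt0)/subset_trans; apply.
by rewrite subUset subxx KedgesS ?sub0set.
Qed.

(** * (R2) and (R3) from rigidity of the dual *)

Lemma rigid_mcl_sub_Kedges d (N : matroid (edge n)) F :
  abstract_rigidity d N -> 0 < d -> mcl N F \subset Kedges (verts F).
Proof.
move=> [_ G1 _] d_gt0; have v0 : verts (set0 : {set edge n}) = set0.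
  by rewrite /verts big_set0.
have := G1 F set0; rewrite setU0 v0 setI0 cards0 => /(_ d_gt0)/subset_trans; apply.
by rewrite subUset subxx KedgesS ?sub0set.
Qed.

Lemma rigid_mcl_Kedges d (N : matroid (edge n)) X :
  abstract_rigidity d N -> 0 < d -> 1 < #|X| -> mcl N (Kedges X) = Kedges X.
Proof.
move=> rN d_gt0 c2; apply/eqP; rewrite eqEsubset sub_mcl andbT.
by rewrite -{2}(verts_Kedges c2) (rigid_mcl_sub_Kedges _ rN).
Qed.

Lemma rigid_mcl_KedgesU d (N : matroid (edge n)) X Y :
  abstract_rigidity d N -> 0 < d -> 1 < #|X| -> 1 < #|Y| -> d <= #|X :&: Y| ->
  mcl N (Kedges X :|: Kedges Y) = Kedges (X :|: Y).
Proof.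
move=> rN d_gt0 cX cY led; have [_ _ G2] := rN.
by rewrite G2 ?verts_setU ?verts_Kedges ?(rigid_mcl_Kedges rN).
Qed.

(** The sets [Z :\ u] and [Z :\ v] share n - t - 1 vertices, so (G2) puts the edge [uv] in the
    closure of the other edges of [Kedges Z]. *)
Lemma abstract_rigidity_codependent Z : t.+1 < n ->
  abstract_rigidity (n - t - 1) (dual M) -> #|Z| = (n - t).+1 ->
  ~~ indep (dual M) (Kedges Z).
Proof.
move=> lt_tn rN cZ; apply/negP => iZ.
have d_gt0 : 0 < n - t - 1 by lia.
have /card_gt0P[u uZ] : 0 < #|Z| by rewrite cZ.
have cZu : #|Z :\ u| = n - t by have := cardsD1 u Z; rewrite uZ cZ add1n => -[->].
have /card_gt0P[v vZu] : 0 < #|Z :\ u| by rewrite cZu; clear -lt_tn; lia.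
have cZuv : #|(Z :\ u) :\ v| = n - t - 1.
  by have := cardsD1 v (Z :\ u); rewrite vZu cZu; clear; lia.
move: vZu; rewrite in_setD1 => /andP[vu vZ].
have cZv : #|Z :\ v| = n - t by have := cardsD1 v Z; rewrite vZ cZ add1n => -[->].
have [e ee] := edge_exists vu.
have eZ : e \in Kedges Z by rewrite inE ee set2_sub vZ.
have := mcl_indepD1 iZ eZ; apply/negP; rewrite negbK.
have := rigid_mcl_KedgesU (X := Z :\ u) (Y := Z :\ v) rN d_gt0.
have eqI : (Z :\ u) :&: (Z :\ v) = (Z :\ u) :\ v.
  by apply/setP => x; rewrite !inE; case: (x \in Z); rewrite ?andbF ?andbT // andbC.
have eqU : (Z :\ u) :|: (Z :\ v) = Z.
  apply/setP => x; rewrite !inE -andb_orl; case: eqVneq => // ->.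
  by rewrite eq_sym vu.
rewrite eqI eqU cZu cZv cZuv leqnn.
have -> : 1 < n - t by clear -lt_tn; lia.
move=> /(_ isT isT isT) cl; rewrite -cl in eZ; apply: subsetP eZ; apply: mclS.
rewrite subUset !subsetD1 !KedgesS ?subD1set //= !inE ee !set2_sub.
by rewrite !inE !eqxx /= andbF.
Qed.

Lemma abstract_rigidity_R3 : t.+1 < n ->
  abstract_rigidity (n - t - 1) (dual M) -> R3star t M.
Proof.
move=> lt_tn rN; apply/R3starP => u Y uY cY.
have d_gt0 : 0 < n - t - 1 by lia.
have [_ G1 _] := rN.
have cuY : #|u |: Y| = t.+2 by rewrite cardsU1 uY cY.
have cuY' : #|~: (u |: Y)| = n - t - 2 by rewrite cardsCs setCK cuY card_ord; clear; lia.
apply: circuitI => [|e eS]; last first.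
  have [y yY ee] := starP _ uY eS; rewrite -indep_dual_spanning -subTset.
  have yu : y != u by apply: contraNneq uY => <-.
  (* These n - t - 1 vertices are the neighbours of [u] once [e] is put back; they are also the
     common vertices of the two complete graphs to which (G2) applies. *)
  pose D := y |: ~: (u |: Y).
  have uD : u \notin D by rewrite !inE eqxx eq_sym (negbTE yu).
  have cD : #|D| = n - t - 1.
    by rewrite cardsU1 cuY' !inE yY orbT /=; clear -lt_tn; lia.
  have cuD : #|u |: D| = n - t by rewrite cardsU1 uD cD; clear -lt_tn; lia.
  have sK1 : Kedges (u |: D) \subset ~: (star u Y :\ e).
    apply/subsetP => f; rewrite !inE => fD; rewrite negb_and negbK.
    case: (boolP (_ && _)) => [/andP[uf fY]|]; last by rewrite orbT.
    rewrite orbF -val_eqE /= eqEcard (eqP (valP e)) (eqP (valP f)) leqnn andbT ee.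
    apply/subsetP => x xf; have := subsetP fD x xf; have := subsetP fY x xf.
    by rewrite !inE; case: eqVneq => //= _; case: eqVneq => //= _ ->.
  have sK2 : Kedges (~: [set u]) \subset ~: (star u Y :\ e).
    apply/subsetP => f; rewrite !inE => fu; rewrite negb_and negbK.
    case: (boolP (u \in _)) => [uf|]; last by rewrite orbT.
    by have := subsetP fu u uf; rewrite !inE eqxx.
  have eqT : ~: [set u] :|: (u |: D) = setT.
    by apply/setP => x; rewrite !inE; case: eqVneq.
  have cu : #|~: [set u]| = n.-1.
    by rewrite cardsCs setCK cards1 card_ord subn1.
  (* For n = 2 the complete graph on [~: [set u]] has no edge and loses its vertex, but [u |: D] is
     already everything. *)
  have [n2|n2] := leqP n 2.
    have eqD : u |: D = setT.
      by apply/eqP; rewrite eqEcard subsetT cardsT card_ord cuD; clear -n2 lt_tn; lia.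
    by rewrite -KedgesT -eqD (subset_trans sK1) ?sub_mcl.
  have := @rigid_mcl_KedgesU _ _ (~: [set u]) (u |: D) rN d_gt0.
  have -> : ~: [set u] :&: (u |: D) = D.
    apply/setP => x; rewrite !inE; case: eqVneq => //= ->.
    by rewrite eq_sym (negbTE yu).
  rewrite cu cD cuD eqT leqnn.
  have -> : 1 < n.-1 by clear -n2; lia.
  have -> : 1 < n - t by clear -lt_tn; lia.
  rewrite KedgesT => /(_ isT isT isT) <-; apply: mclS.
  by rewrite subUset sK1 sK2.
rewrite -indep_dual_spanning; apply/eqP => full.
have /card_gt0P[y yY] : 0 < #|Y| by rewrite cY.
have yu : y != u by apply: contraNneq uY => <-.
have [e ee] := edge_exists yu.
(* The two pieces share at most n - t - 2 vertices, so (G1) keeps the edge [uy] out of the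
   closure. *)
have eqC : ~: star u Y = Kedges (~: [set u]) :|: star u (~: (u |: Y)).
  apply/setP => f; rewrite !inE.
  have -> : (val f \subset ~: [set u]) = (u \notin val f).
    by rewrite subsetC sub1set inE.
  case: (boolP (u \in val f)) => //= uf; have [x xu ->] := edge_at uf.
  by rewrite !set2_sub !inE !eqxx (negbTE xu) /=.
have : e \in mcl (dual M) (~: star u Y) by rewrite full inE.
have sV1 : verts (Kedges (~: [set u])) \subset ~: [set u] by rewrite verts_sub subxx.
have sV2 : verts (star u (~: (u |: Y))) \subset u |: ~: (u |: Y).
  by rewrite verts_sub star_sub.
have ltd : #|verts (Kedges (~: [set u])) :&: verts (star u (~: (u |: Y)))| < n - t - 1.
  apply: leq_ltn_trans (subset_leq_card (setISS sV1 sV2)) _.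
  rewrite setIUr setIC setICr set0U.
  apply: leq_ltn_trans (subset_leq_card (subsetIr _ _)) _.
  by rewrite cuY'; clear -lt_tn; lia.
rewrite eqC => /(subsetP (G1 _ _ ltd)).
rewrite in_setU !inE ee !set2_sub => H.
have : (u \in ~: [set u]) || (y \in u |: ~: (u |: Y)).
  case/orP: H => [/andP[_ u1]|/andP[y2 _]].
    by rewrite (subsetP sV1).
  by rewrite (subsetP sV2) ?orbT.
by rewrite !inE eqxx (negbTE yu) yY.
Qed.

End DualRigidity.

(* For n = t + 1 > 1 the rigidity parameter n - t - 1 is 0, (G1) is vacuous and
   (iv) does not imply the other properties; only that implication is excluded. *)
Theorem lemma2p3 (n t : nat) (M : matroid (edge n)) (le_tn : t + 1 <= n) :
  [/\ (R1star t M /\ R2star t M) <-> (R1star t M /\ R3star t M),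
      (R1star t M /\ R2star t M) <-> (R2star t M /\ R3star t M),
      (R1star t M /\ R2star t M) -> abstract_rigidity (n - t - 1) (dual M)
    & t + 1 < n \/ n = 1 ->
      abstract_rigidity (n - t - 1) (dual M) -> (R1star t M /\ R2star t M)].
Proof.
have lt_tn : t < n by rewrite -addn1.
split.
- split=> -[R1 R]; split=> //; first exact: R1_R2_R3 R1 R.
  exact: R1_R3_R2 R1 R.
- split=> [[R1 R2]|[R2 R3]]; split=> //; first exact: R1_R2_R3 R1 R2.
  exact: R2_R3_R1 R2 R3.
- by case=> R1 R2; apply: R1_R2_abstract_rigidity.
move=> n_case rN.
suff [R2 R3] : R2star t M /\ R3star t M by split=> //; apply: R2_R3_R1.
case: n_case => [lt1|n1].
  rewrite addn1 in lt1; have R3 := abstract_rigidity_R3 lt1 rN.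
  split=> //; apply: R3_codependent_R2 => // Z cZ.
  exact: abstract_rigidity_codependent cZ.
(* Here n = 1 and t = 0: both properties are vacuous, as they concern subgraphs on two vertices. *)
split.
  by apply/R2starP => Z cZ; have := max_card (mem Z); rewrite cZ card_ord; lia.
apply/R3starP => u Y uY cY; have := max_card (mem (u |: Y)).
by rewrite cardsU1 uY cY card_ord; lia.
Qed.
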